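(* Let $T_1,\dots,T_k\colon[0,1]\to[0,1]$ ($k\ge2$) be continuous injective maps, and let $\mathbb P^+$ be a mixing Markov measure on $\Sigma_k^+$ with transition matrix $P=(p_{ij})$. (a) If there is $i\in\{1,\dots,k\}$ such that $\pi$ is not constant in $[i]\cap\mathrm{supp}(\mathbb P^+)\cap S_{\mathrm t}$, then $\mathbb P^+(S_{\mathrm t})=1$. In particular, $$\#\,\pi\big(S_{\mathrm t}\cap\mathrm{supp}(\mathbb P^+)\big)\ge k+1\ \Longrightarrow\ \mathbb P^+(S_{\mathrm t})=1.$$ (b) If the maps $T_1,\dots,T_k$ have no common fixed point and for every $i,j\in\{1,\dots,k\}$ with $i\ne j$ there is $m\in\{1,\dots,k\}$ with $p_{mi}\,p_{mj}>0$, then $$S_{\mathrm t}\cap\mathrm{supp}(\mathbb P^+)\ne\emptyset\ \Longleftrightarrow\ \mathbb P^+(S_{\mathrm t})=1.$$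
   Context: Let $I=[0,1]$, $\Sigma_k^+=\{1,\dots,k\}^{\mathbb N}$ with left shift $\sigma(\xi)_n=\xi_{n+1}$, and cylinders $[a_0\dots a_\ell]=\{\omega\in\Sigma_k^+:\omega_0=a_0,\dots,\omega_\ell=a_\ell\}$. The set of weakly hyperbolic sequences is $S_{\mathrm t}=\{\xi\in\Sigma_k^+ : \lim_{n\to\infty}\mathrm{diam}(T_{\xi_0}\circ\cdots\circ T_{\xi_n}(I))=0\}$. The coding map $\pi\colon S_{\mathrm t}\to I$ is $\pi(\xi)=\lim_{n\to\infty}T_{\xi_0}\circ\cdots\circ T_{\xi_n}(p)$, which does not depend on $p\in I$. $\#$ denotes cardinality. No common fixed point means there is no $x\in I$ with $T_i(x)=x$ for all $i$. A transition matrix is a $k\times k$ matrix $P=(p_{ij})$ with $p_{ij}\ge0$ and $\sum_jp_{ij}=1$ for every $i$. It is irreducible if for all $\ell,r$ some power $P^n$ has positive $(\ell,r)$ entry; it then has a unique stationary probability vector $\bar p=(p_1,\dots,p_k)$, $\bar pP=\bar p$. The Markov measure $\mathbb P^+$ associated to an irreducible transition matrix $P$ (and $\bar p$) is the Borel probability on $\Sigma_k^+$ with $\mathbb P^+([a_0\dots a_\ell])=p_{a_0}p_{a_0a_1}\cdots p_{a_{\ell-1}a_\ell}$. It is mixing if $\lim_{n\to\infty}\mathbb P^+(\sigma^{-n}(A)\cap B)=\mathbb P^+(A)\mathbb P^+(B)$ for all Borel $A,B$. *)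

(* Defs.v *)
From HB Require Import structures.
From mathcomp Require Import all_boot all_order all_algebra.
From mathcomp Require Import all_classical all_reals all_analysis.
From mathcomp Require Import lra.

Set Implicit Arguments.
Unset Strict Implicit.
Unset Printing Implicit Defensive.

Import Order.TTheory GRing.Theory Num.Theory.
Import numFieldNormedType.Exports.

Local Open Scope classical_set_scope.
Local Open Scope ring_scope.

(* The one-sided full shift on k symbols. The proof that k >= 2 is a parameter
   because measurable types are pointed, hence the alphabet must be nonempty. *)
Definition Sigma (k : nat) (hk : (2 <= k)%N) : Type :=
  prod_topology (fun _ : nat => discrete_topology 'I_k).

HB.instance Definition _ k hk := Choice.on (@Sigma k hk).
HB.instance Definition _ k hk :=
  isPointed.Build (@Sigma k hk) (fun _ => Ordinal (ltnW hk)).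
HB.instance Definition _ k hk := Nbhs.on (@Sigma k hk).
HB.instance Definition _ k hk := Topological.on (@Sigma k hk).

(* The full shift with its Borel sigma-algebra. *)
Notation borel_Sigma hk := (g_sigma_algebraType (@open (Sigma hk))).

Section SymbolicDynamics.
Context {R : realType} {k : nat} {hk : (2 <= k)%N}.
Implicit Types (T : 'I_k -> R -> R) (xi : Sigma hk) (P : 'M[R]_k)
  (p : 'rV[R]_k) (mu : probability (borel_Sigma hk) R).

Definition shift (xi : Sigma hk) : Sigma hk := fun n => xi n.+1.

(* [a_0 ... a_l]; only the values of a at 0, ..., l matter. *)
Definition cylinder (a : nat -> 'I_k) (l : nat) : set (Sigma hk) :=
  [set w | forall j, (j <= l)%N -> w j = a j].

(* T_{xi_0} \o ... \o T_{xi_n} *)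
Fixpoint compo T xi (n : nat) : R -> R :=
  if n is m.+1 then compo T xi m \o T (xi n) else T (xi 0%N).

Definition diam (A : set R) : R := sup [set `|z.1 - z.2| | z in A `*` A].

Definition weakly_hyperbolic T : set (Sigma hk) :=
  [set xi | diam (compo T xi n @` `[0, 1]) @[n --> \oo] --> (0 : R)].

(* Only meaningful on weakly_hyperbolic T, where the limit exists and the base
   point 0 can be replaced by any other point of [0, 1]: see cvg_coding. *)
Definition coding T xi : R := lim (compo T xi n 0 @[n --> \oo]).

Definition constant_on (f : Sigma hk -> R) (A : set (Sigma hk)) :=
  forall xi eta, A xi -> A eta -> f xi = f eta.

Definition transition_matrix P :=
  (forall i j, 0 <= P i j) /\ (forall i, \sum_j P i j = 1).

Definition irreducible_matrix P :=
  forall i j, exists2 n, (0 < n)%N & 0 < (P ^+ n) i j.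

Definition stationary P p :=
  [/\ forall i, 0 <= p 0 i, \sum_i p 0 i = 1 & p *m P = p].

Definition markov_measure P mu :=
  [/\ transition_matrix P, irreducible_matrix P &
    exists2 p, stationary P p &
      forall (a : nat -> 'I_k) (l : nat),
        mu (cylinder a l) =
        (p 0 (a 0%N) * \prod_(j < l) P (a j) (a j.+1))%:E].

Definition mixing mu :=
  forall A B : set (borel_Sigma hk), measurable A -> measurable B ->
    mu ((iter n shift @^-1` A) `&` B) @[n --> \oo] --> (mu A * mu B)%E.

Definition supp mu : set (Sigma hk) :=
  [set xi | forall U : set (Sigma hk), open U -> U xi -> (0 < mu U)%E].

Section CodingWellDefined.
Variables (T : 'I_k -> R -> R).
Hypothesis TI : forall i, {homo T i : x / x \in `[0, 1]}.

Lemma compo_itv xi n : {homo compo T xi n : x / x \in `[0, 1]}.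
Proof.
by elim: n => [|n IH] x xI /=; [exact: TI|apply: IH; exact: TI].
Qed.

Lemma compo_nested xi n m x : (n <= m)%N -> x \in `[0, 1] ->
  exists2 y, y \in `[0, 1] & compo T xi m x = compo T xi n y.
Proof.
elim: m x => [|m IH] x; first by rewrite leqn0 => /eqP -> xI; exists x.
rewrite leq_eqVlt => /predU1P[-> xI|]; first by exists x.
by rewrite ltnS => nm xI; apply: IH => //; exact: TI.
Qed.

Lemma dist_compo_le_diam xi n x y : x \in `[0, 1] -> y \in `[0, 1] ->
  `|compo T xi n x - compo T xi n y| <= diam (compo T xi n @` `[0, 1]).
Proof.
move=> xI yI; apply: ub_le_sup.
  exists 1 => _ [[_ _] [/= [u uI <-] [v vI <-]] <-].
  have := compo_itv xi n uI; have := compo_itv xi n vI.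
  rewrite !in_itv /= => /andP[v0 v1] /andP[u0 u1].
  by rewrite ler_norml; apply/andP; split; lra.
by exists (compo T xi n x, compo T xi n y) => //=; split; [exists x|exists y].
Qed.

Lemma cvg_coding xi x : weakly_hyperbolic T xi -> x \in `[0, 1] ->
  compo T xi n x @[n --> \oo] --> coding T xi.
Proof.
move=> hyp xI.
have zI : (0 : R) \in `[0, 1] by rewrite in_itv /= lexx ler01.
have small e : 0 < e ->
    \forall n \near \oo, diam (compo T xi n @` `[0, 1]) < e.
  move=> e0; move/cvgrPdist_lt : hyp => /(_ _ e0); apply: filterS => n.
  by rewrite sub0r normrN; apply: le_lt_trans; exact: ler_norm.
have cvg0 : compo T xi n 0 @[n --> \oo] --> coding T xi.
  apply: cauchy_cvg; apply/cauchy_exP => e e0.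
  have [N _ HN] := small _ e0.
  exists (compo T xi N 0); exists N => // m Nm /=.
  have [y yI ->] := compo_nested xi Nm zI.
  exact: le_lt_trans (dist_compo_le_diam xi N zI yI) (HN N (leqnn N)).
apply/cvgrPdist_lt => e e0.
have e2 : 0 < e / 2 by rewrite divr_gt0.
move/cvgrPdist_lt : cvg0 => /(_ _ e2) cvg0.
near=> n; rewrite (splitr e).
rewrite (le_lt_trans (ler_distD (compo T xi n 0) _ _))// ltrD//.
  by near: n.
rewrite (le_lt_trans (dist_compo_le_diam xi n zI xI))//.
by near: n; exact: small.
Unshelve. all: by end_near. Qed.

End CodingWellDefined.

End SymbolicDynamics.

(* Main.v *)
Require Import Defs.
From mathcomp Require Import all_boot all_order all_algebra.
From mathcomp Require Import all_classical all_reals all_analysis.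
From mathcomp Require Import lra.
Import Order.TTheory GRing.Theory Num.Theory.
Import numFieldNormedType.Exports.
Local Open Scope classical_set_scope.
Local Open Scope ring_scope.

Set Implicit Arguments.
Unset Strict Implicit.
Unset Printing Implicit Defensive.

(** Write [T_w] for [T_{w_0} \o ... \o T_{w_n}] and [I] for the unit interval.
    All three claims reduce to one sufficient condition, called [splitting]
    below: some state can be followed, with positive probability, by each of
    two words [a] and [b] whose images [T_a(I)] and [T_b(I)] are disjoint.

    Splitting implies that almost every sequence is weakly hyperbolic
    ([splitting_weakly_hyperbolic]). A point [x] lies in at most one of the two
    images, and by injectivity in at most one of [T_v(T_a(I))] and
    [T_v(T_b(I))] for every word [v]. By irreducibility some [v] leads from any
    given state to the one at which [a] and [b] compete; hence, from every
    state, the probability that [x] still lies in [T_w(I)] after [N] random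
    symbols [w] is at most some [c < 1]. As [x] lies in [T_i(T_w(I))] exactly
    when the unique preimage of [x] under [T_i] exists and lies in [T_w(I)],
    these bounds multiply over successive blocks, and [x] is still covered
    after [j * N] symbols with probability at most [c ^ j]
    ([splitting_hit_prob_geometric]). Finally, [T_w(I)] is an interval, so as
    soon as its diameter is at least [e] it contains a point of a fixed finite
    grid of mesh less than [e / 2]. The union bound over the grid makes it
    unlikely that the decreasing diameters stay above [e].

    Splitting is in turn obtained from two weakly hyperbolic sequences [xi] and
    [eta] in the support with [T_c (coding xi) <> T_d (coding eta)], where [c]
    followed by [xi] and [d] followed by [eta] can both be read from a common
    state ([splitting_of_codings]): the images along long prefixes shrink to
    these two distinct points. If the coding map is not constant
    on the sequences starting with [i], take [c] and [d] empty and a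
    predecessor of [i] as common state. By the pigeonhole principle this
    happens for some [i] if the coding map has more than [k] values. If there
    is no common fixed point, start from one weakly hyperbolic [xi] in the
    support with [x := coding xi]. If [T_w x = x] for every word [w] that can
    precede [xi], then every [T_j] fixes [x], because [j] is the first letter
    of such a word, whose tail fixes [x] as well; so some [T_w x] differs from
    [x], and the hypothesis on columns of the matrix gives a state that can
    precede both [w] and [xi].

    For the remaining implication, the support has full measure
    ([negligible_supp_compl]), so that it meets every event of probability 1. *)

(** * Path probabilities of a transition matrix *)

Section PathProbabilities.
Context {R : realType} {k : nat}.
Implicit Types (P : 'M[R]_k) (s : 'I_k) (w : seq 'I_k) (G : pred (seq 'I_k)).

(** The state [s] comes before the first letter of [w] and is not part of it. *)
Fixpoint path_weight P s w : R :=
  if w is i :: w' then P s i * path_weight P i w' else 1.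

(** The probability that the [n] states visited after [s] spell a word in [G].
    Conditioning on the first letter replaces [G] by its left quotient by that
    letter, which gives a recursion without enumerating the words. *)
Fixpoint word_prob P n s G : R :=
  if n is m.+1 then \sum_i P s i * word_prob P m i (fun w => G (i :: w))
  else (G [::])%:R.

Lemma path_weight_cat P s w1 w2 :
  path_weight P s (w1 ++ w2) = path_weight P s w1 * path_weight P (last s w1) w2.
Proof.
by elim: w1 s => [|i w1 IH] s /=; rewrite ?mul1r// IH mulrA.
Qed.

Lemma irreducible_path P i j : transition_matrix P -> irreducible_matrix P ->
  exists w, [/\ w != [::], last i w = j & 0 < path_weight P i w].
Proof.
move=> [P0 _] /(_ i j)[n n0 Pn].
have [w [sw lw ww]] : exists w, [/\ size w = n, last i w = j & 0 < path_weight P i w].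
  elim: n {n0} i Pn => [|n IH] i.
    rewrite expr0 mxE; case: eqP => [<-|_]; rewrite ?ltxx// => _.
    by exists [::]; split.
  rewrite exprS => Pn.
  have [l Pl] : exists l, 0 < P i l * (P ^+ n) l j.
    apply: contrapT => /forallNP Pl; move: Pn; rewrite mxE.
    apply/negP; rewrite -leNgt; apply: sumr_le0 => l _.
    by rewrite leNgt; apply/negP/Pl.
  have Pil : 0 < P i l.
    by rewrite lt_neqAle P0 andbT; apply: contraTneq Pl => <-; rewrite mul0r ltxx.
  have [|w [sw lw ww]] := IH l; first by rewrite -(pmulr_rgt0 _ Pil).
  by exists (l :: w); split; rewrite /= ?sw ?mulr_gt0.
by exists w; split => //; rewrite -size_eq0 sw -lt0n.
Qed.

Lemma irreducible_pred P i : transition_matrix P -> irreducible_matrix P ->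
  exists m, 0 < P m i.
Proof.
move=> tP iP; have [w [w0 lw ww]] := irreducible_path i i tP iP.
have [P0 _] := tP; case/lastP: w w0 lw ww => // w j _.
rewrite last_rcons -cats1 path_weight_cat /= mulr1 => -> ww.
exists (last i w); rewrite lt_neqAle P0 andbT.
by apply: contraTneq ww => <-; rewrite mulr0 ltxx.
Qed.

Section Transition.
Variable P : 'M[R]_k.
Hypothesis tP : transition_matrix P.

Let P0 i j : 0 <= P i j. Proof. by case: tP. Qed.
Let P1 i : \sum_j P i j = 1. Proof. by case: tP. Qed.

Lemma path_weight_ge0 s w : 0 <= path_weight P s w.
Proof. by elim: w s => //= i w IH s; rewrite mulr_ge0. Qed.

Lemma transition_avg_le (f : 'I_k -> R) s a :
  (forall i, f i <= a) -> \sum_i P s i * f i <= a.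
Proof.
move=> fa; rewrite -[leRHS]mul1r -(P1 s) mulr_suml.
by apply: ler_sum => i _; apply: ler_wpM2l.
Qed.

Lemma eq_word_prob n s G1 G2 : G1 =1 G2 -> word_prob P n s G1 = word_prob P n s G2.
Proof.
elim: n s G1 G2 => [|n IH] s G1 G2 eG /=; first by rewrite eG.
by apply: eq_bigr => i _; rewrite (IH i _ (fun w => G2 (i :: w))).
Qed.

Lemma word_prob_le1 n s G : word_prob P n s G <= 1.
Proof.
elim: n s G => [|n IH] s G /=; first by rewrite lern1 leq_b1.
exact: transition_avg_le.
Qed.

Lemma word_prob_pred0 n s : word_prob P n s pred0 = 0.
Proof.
elim: n s => //= n IH s; apply: big1 => i _.
by rewrite [X in _ * X](IH i) mulr0.
Qed.

(** The paths that start with [a] carry exactly the mass [path_weight P s a],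
    whatever the remaining [n - size a] letters are, and all of them are lost. *)
Lemma word_prob_avoid n s a G : (size a <= n)%N -> (forall w, ~~ G (a ++ w)) ->
  word_prob P n s G <= 1 - path_weight P s a.
Proof.
elim: a n s G => [|i a IH] n s G /=.
  move=> _ Ga; rewrite subrr (@eq_word_prob _ _ _ pred0) ?word_prob_pred0//.
  by move=> w; apply/negbTE/Ga.
case: n => // n an Ga /=.
rewrite -[X in X - _](P1 s) (bigD1 i)//= [X in _ <= X - _](bigD1 i)//=.
have : P s i * word_prob P n i (fun w => G (i :: w)) <=
    P s i * (1 - path_weight P i a).
  by apply: ler_wpM2l => //; apply: IH.
have : \sum_(j < k | j != i) P s j * word_prob P n j (fun w => G (j :: w)) <=
    \sum_(j < k | j != i) P s j.
  by apply: ler_sum => j _; rewrite ler_piMr// word_prob_le1.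
lra.
Qed.

End Transition.
End PathProbabilities.

(** * Compositions of the maps along finite words *)

Section Words.
Context {R : realType} {k : nat}.
Variable T : 'I_k -> R -> R.
Hypothesis TI : forall i x, x \in `[0, 1] -> T i x \in `[0, 1].
Implicit Types (w : seq 'I_k) (x y e : R).

Definition word_map w : R -> R := foldr (fun i f => T i \o f) id w.

(** Membership of [x] in the image of the unit interval, as a boolean predicate
    on words so that [word_prob] applies to it. *)
Definition hits x : pred (seq 'I_k) :=
  fun w => `[< exists2 t, t \in `[0, 1] & word_map w t = x >].

Lemma word_map_cat w1 w2 x : word_map (w1 ++ w2) x = word_map w1 (word_map w2 x).
Proof. by elim: w1 => //= i w1 ->. Qed.

Lemma word_map_itv w x : x \in `[0, 1] -> word_map w x \in `[0, 1].
Proof. by move=> xI; elim: w => //= i w; exact: TI. Qed.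

Lemma compo_word_map (hk : (2 <= k)%N) (xi : Sigma hk) n x :
  compo T xi n x = word_map (mkseq xi n.+1) x.
Proof.
elim: n x => // n IH x.
by rewrite [LHS]IH [in RHS]mkseqS -cats1 word_map_cat.
Qed.

Lemma hits_cat x a w : hits x (a ++ w) -> hits x a.
Proof.
move=> /asboolP[t tI <-]; apply/asboolP; exists (word_map w t).
  exact: word_map_itv.
by rewrite word_map_cat.
Qed.

Section Injective.
Hypothesis Tinj : forall i, {in `[0, 1] &, injective (T i)}.

Lemma word_map_inj w : {in `[0, 1] &, injective (word_map w)}.
Proof.
elim: w => //= i w IH x y xI yI /= /Tinj; rewrite !word_map_itv// => /(_ _ _).
by move=> e; apply: IH => //; exact: e.
Qed.

Lemma hits_cons i y w : y \in `[0, 1] -> hits (T i y) (i :: w) = hits y w.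
Proof.
move=> yI; apply/asboolP/asboolP => -[t tI /=].
  by move=> /Tinj-/(_ (word_map_itv w tI) yI) <-; exists t.
by move=> <-; exists t.
Qed.

(** This is what lets bounds uniform in the point be iterated: thanks to
    injectivity, being hit by a word that starts with [i] amounts to a single
    other point being hit by its tail. *)
Lemma hits_cons_preimage i x :
  (exists2 y, y \in `[0, 1] & forall w, hits x (i :: w) = hits y w) \/
  (forall w, hits x (i :: w) = false).
Proof.
have [[y yI <-]|noy] := pselect (exists2 y, y \in `[0, 1] & T i y = x).
  by left; exists y => // w; exact: hits_cons.
right => w; apply/asboolP => -[t tI /= tx]; apply: noy.
by exists (word_map w t) => //; exact: word_map_itv.
Qed.

End Injective.

Section Continuous.
Hypothesis Tcont : forall i, {within `[0, 1], continuous (T i)}.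

(** Induction on the word only needs the intermediate value theorem for a single
    map. The points [x] and [y] come in either order, since the maps may
    reverse orientation. *)
Lemma word_map_ivt w x y z : x \in `[0, 1] -> y \in `[0, 1] ->
  word_map w x <= z <= word_map w y -> hits z w.
Proof.
elim: w x y z => [|i w IH] x y z xI yI.
  move=> /= /andP[xz zy]; apply/asboolP; exists z => //.
  move: xI yI; rewrite !in_itv /= => /andP[x0 _] /andP[_ y1].
  by rewrite (le_trans x0)// (le_trans zy).
have ivt a b : a \in `[0, 1] -> b \in `[0, 1] -> a <= b ->
    Num.min (T i a) (T i b) <= z <= Num.max (T i a) (T i b) ->
    exists2 c, a <= c <= b & T i c = z.
  move=> aI bI ab zab; have subI : `[a, b] `<=` `[0, 1].
    move=> c /=; move: aI bI; rewrite !in_itv/=.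
    move=> /andP[a0 _] /andP[_ b1] /andP[ac cb].
    by rewrite (le_trans a0)// (le_trans cb).
  have [c cab cz] := IVT ab (continuous_subspaceW subI (@Tcont i)) zab.
  by exists c.
have uI := word_map_itv w xI; have vI := word_map_itv w yI.
rewrite /= => /andP[uz zv].
have [c /asboolP[t tI tc] cz] : exists2 c, hits c w & T i c = z.
  have [uv|/ltW vu] := leP (word_map w x) (word_map w y).
    have [|c cI <-] := ivt _ _ uI vI uv.
      by rewrite ge_min le_max uz zv orbT.
    by exists c => //; exact: IH cI.
  have [|c cI <-] := ivt _ _ vI uI vu.
    by rewrite ge_min le_max uz zv !orbT.
  by exists c => //; exact: IH cI.
by apply/asboolP; exists t => //=; rewrite tc.
Qed.

Lemma word_map_continuous w x e : x \in `[0, 1] -> 0 < e ->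
  exists2 d, 0 < d & forall y, y \in `[0, 1] -> `|x - y| < d ->
    `|word_map w x - word_map w y| < e.
Proof.
move=> xI; elim: w e => [|i w IH] e e0 /=; first by exists e.
have wI := word_map_itv w xI.
have : within `[0, 1] (nbhs (word_map w x))
    [set y | `|T i (word_map w x) - T i y| < e].
  rewrite nbhs_subspace_in //.
  have /cvgrPdist_lt := @Tcont i (word_map w x).
  exact.
rewrite /within/= => /nbhs_ballP[d d0 dP].
have [d' d'0 d'P] := IH _ d0; exists d' => // y yI xy.
by apply: dP; [exact: d'P|exact: word_map_itv].
Qed.

End Continuous.
End Words.

(** * Splitting and geometric decay of hitting probabilities *)

Section Decay.
Context {R : realType} {k : nat}.
Variables (P : 'M[R]_k) (T : 'I_k -> R -> R).
Hypothesis tP : transition_matrix P.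
Hypothesis TI : forall i x, x \in `[0, 1] -> T i x \in `[0, 1].
Hypothesis Tinj : forall i, {in `[0, 1] &, injective (T i)}.

(** [m] is a state from which both words can be read; it precedes their
    first letters, so that [a] and [b] may start differently. *)
Definition splitting := exists m a b,
  [/\ 0 < path_weight P m a, 0 < path_weight P m b &
      forall x, ~~ (hits T x a && hits T x b)].

Let hit_prob n s x := word_prob P n s (hits T x).

Lemma hit_prob0 s x : x \in `[0, 1] -> hit_prob 0 s x = 1.
Proof.
by move=> xI; rewrite /hit_prob /=; have -> : hits T x [::] by apply/asboolP; exists x.
Qed.

(** Reading the first [m] letters moves the point [x] to a preimage of it, or
    loses it; the uniform bound [c] then applies to the last [n] letters. *)
Lemma hit_prob_add m n s x c : 0 <= c ->
  (forall s x, x \in `[0, 1] -> hit_prob n s x <= c) -> x \in `[0, 1] ->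
  hit_prob (m + n) s x <= c * hit_prob m s x.
Proof.
move=> c0 nc; elim: m s x => [|m IH] s x xI.
  by rewrite hit_prob0// mulr1 nc.
rewrite addSn /hit_prob /= mulr_sumr; apply: ler_sum => i _.
rewrite mulrCA; apply: ler_wpM2l; first by case: tP.
have [[y yI xy]|xN] := hits_cons_preimage TI Tinj i x.
  by rewrite !(eq_word_prob _ _ _ xy); exact: IH.
by rewrite !(@eq_word_prob _ _ _ _ _ _ pred0)// !word_prob_pred0 mulr0.
Qed.

Lemma hit_prob_antitone m n s x : (m <= n)%N -> x \in `[0, 1] ->
  hit_prob n s x <= hit_prob m s x.
Proof.
move=> mn xI; rewrite -(subnKC mn) -[leRHS]mul1r; apply: hit_prob_add => //.
by move=> s' y _; exact: word_prob_le1.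
Qed.

(** From the state [s], first go to the state [m] of the splitting along [w]: a
    given [x] misses the image of [w ++ a] or that of [w ++ b]. The number of
    letters depends on [s], and is made uniform by monotonicity in time. *)
Lemma splitting_hit_prob : irreducible_matrix P -> splitting ->
  exists N c, [/\ 0 <= c, c < 1 &
    forall s x, x \in `[0, 1] -> hit_prob N s x <= c].
Proof.
move=> iP [m [a [b [ma mb ab]]]].
have /choice[nd ndP] : forall s, exists nd : nat * R, 0 < nd.2 /\
    forall x, x \in `[0, 1] -> hit_prob nd.1 s x <= 1 - nd.2.
  move=> s; have [w [_ ws sw]] := irreducible_path s m tP iP.
  (* Both words w ++ a and w ++ b fit in this length. *)
  exists (size w + (size a + size b),
    Num.min (path_weight P s (w ++ a)) (path_weight P s (w ++ b)))%N.
  split=> [|x xI] /=; first by rewrite lt_min !path_weight_cat ws !mulr_gt0.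
  have [xa|xa] := boolP (hits T x (w ++ a)); last first.
    apply: (@le_trans _ _ (1 - path_weight P s (w ++ a))).
      apply: word_prob_avoid => // [|v].
        by rewrite size_cat leq_add2l leq_addr.
      by apply: contra xa; exact: hits_cat.
    by rewrite lerD2l lerN2 ge_min lexx.
  have xb : ~~ hits T x (w ++ b).
    apply/negP => /asboolP[v vI xv]; move/asboolP: xa => [u uI].
    rewrite -{}xv !word_map_cat => uv.
    have /(_ (word_map T a u)) := ab; apply/negP; rewrite negbK.
    apply/andP; split; apply/asboolP; first by exists u.
    exists v => //; symmetry.
    by apply: (@word_map_inj _ _ _ TI Tinj w) uv; exact: word_map_itv.
  apply: (@le_trans _ _ (1 - path_weight P s (w ++ b))).
    apply: word_prob_avoid => // [|v].
      by rewrite size_cat leq_add2l leq_addl.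
    by apply: contra xb; exact: hits_cat.
  by rewrite lerD2l lerN2 ge_min lexx orbT.
exists (\sum_s (nd s).1)%N, (\big[Num.max/0]_s (1 - (nd s).2)); split.
- exact: bigmax_ge_id.
- by apply: bigmax_lt => // s _; have [nd0 _] := ndP s; lra.
- move=> s x xI; have [_ /(_ x xI) hs] := ndP s.
  apply: (le_trans (hit_prob_antitone s _ xI) (le_trans hs _)).
    by rewrite (bigD1 s)//= leq_addr.
  exact: le_bigmax.
Qed.

Lemma splitting_hit_prob_geometric : irreducible_matrix P -> splitting ->
  exists N c, [/\ 0 <= c, c < 1 &
    forall j s x, x \in `[0, 1] -> hit_prob (j * N) s x <= c ^+ j].
Proof.
move=> iP sP; have [N [c [c0 c1 Nc]]] := splitting_hit_prob iP sP.
exists N, c; split => //; elim=> [|j IH] s x xI.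
  by rewrite expr0 word_prob_le1.
rewrite mulSn addnC exprS.
apply: le_trans (hit_prob_add _ _ c0 Nc xI) _.
by apply: ler_wpM2l => //; exact: IH.
Qed.

End Decay.

(** * Cylinders in the shift space *)

Section ShiftSpace.
Context {k : nat} {hk : (2 <= k)%N}.
Implicit Types (w : Sigma hk) (U : set (Sigma hk)) (G : pred (seq 'I_k)).

Lemma nbhs_cylinder w l : nbhs w (cylinder w l).
Proof.
have coord j : nbhs w [set v : Sigma hk | v j = w j].
  have := @proj_continuous nat (fun=> discrete_topology 'I_k) j w.
  by move=> /(_ [set w j]); apply; exact: discrete_set1.
elim: l => [|l IH].
  by apply: filterS (coord 0%N) => v vw j; rewrite leqn0 => /eqP ->.
apply: filterS (filterI IH (coord l.+1)) => v [vl vw] j.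
by rewrite leq_eqVlt => /predU1P[->//|]; rewrite ltnS; exact: vl.
Qed.

(** Otherwise one could pick, for every [l], a point of the cylinder of length
    [l] outside [U]; these points converge to [w] coordinatewise. *)
Lemma nbhs_cylinder_sub w U : nbhs w U -> exists l, cylinder w l `<=` U.
Proof.
move=> wU; apply: contrapT => /forallNP noU.
have /choice[v vP] : forall l, exists v, cylinder w l v /\ ~ U v.
  by move=> l; have /existsNP[v /not_implyP ?] := noU l; exists v.
have vw : v l @[l --> \oo] --> w.
  apply/(@cvg_sup) => i A; rewrite nbhsE => -[B [[C oC <-] Cw] BA].
  rewrite nbhs_simpl; exists i => // l /= il; apply: BA => /=.
  by have [/(_ i il) -> _] := vP l.
have [l _ /(_ l (leqnn l))] := vw _ wU.
by have [_] := vP l.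
Qed.

Lemma cylinder_mkseq (a : nat -> 'I_k) l w :
  cylinder a l w <-> mkseq w l.+1 = mkseq a l.+1.
Proof.
split=> [wa|wa j jl]; first by apply/eq_in_map => j; rewrite mem_iota => /wa.
have := congr1 (fun s => nth (w 0%N) s j) wa.
by rewrite !nth_mkseq.
Qed.

Lemma open_words n (G : set (seq 'I_k)) : open [set w : Sigma hk | G (mkseq w n)].
Proof.
rewrite openE => w Gw; case: n Gw => [|n] Gw; first exact: filterS (nbhs_cylinder w 0).
by apply: filterS (nbhs_cylinder w n) => v /cylinder_mkseq /= ->.
Qed.

Lemma open_cylinder (a : nat -> 'I_k) l : open (cylinder a l : set (Sigma hk)).
Proof.
have -> : cylinder a l = [set w : Sigma hk | mkseq w l.+1 = mkseq a l.+1].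
  by apply/seteqP; split=> w /cylinder_mkseq.
exact: (@open_words l.+1 [set mkseq a l.+1]).
Qed.

Lemma measurable_words n (G : set (seq 'I_k)) :
  measurable ([set w | G (mkseq w n)] : set (borel_Sigma hk)).
Proof. by apply: sub_sigma_algebra; exact: open_words. Qed.

Lemma measurable_cylinder (a : nat -> 'I_k) l :
  measurable (cylinder a l : set (borel_Sigma hk)).
Proof. by apply: sub_sigma_algebra; exact: open_cylinder. Qed.

End ShiftSpace.

(** * The Markov measure of events depending on finitely many symbols *)

Lemma measure_le_sum_cover d (X : measurableType d) (R : realType)
    (mu : {measure set X -> \bar R}) (I : finType) (A : set X) (F : I -> set X) :
  measurable A -> (forall i, measurable (F i)) -> A `<=` \bigcup_i F i ->
  (mu A <= \sum_i mu (F i))%E.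
Proof.
move=> mA mF AF; rewrite -big_enum /= fsbig_seq ?enum_uniq//.
apply: content_sub_fsum => // x /AF[i _ Fx].
by exists i => //=; rewrite mem_enum.
Qed.

Lemma mkseq_recl {X : Type} (f : nat -> X) n :
  mkseq f n.+1 = f 0%N :: mkseq (f \o S) n.
Proof. by rewrite /mkseq /= (iotaDl 1 0) -map_comp. Qed.

Lemma drop_mkseq {X : Type} (f : nat -> X) n m :
  drop n (mkseq f (n + m)) = mkseq (fun i => f (n + i)%N) m.
Proof.
apply: (@eq_from_nth _ (f 0%N)); rewrite size_drop !size_mkseq addKn// => i im.
by rewrite nth_drop !nth_mkseq// ltn_add2l.
Qed.

Section MarkovMeasure.
Context {R : realType} {k : nat} {hk : (2 <= k)%N}.
Variables (P : 'M[R]_k) (p : 'rV[R]_k) (mu : probability (borel_Sigma hk) R).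
Hypothesis muP : forall (a : nat -> 'I_k) (l : nat), mu (cylinder a l) =
  (p 0 (a 0%N) * \prod_(j < l) P (a j) (a j.+1))%:E.

Lemma cylinder_prob_extend (a : nat -> 'I_k) l i :
  mu (cylinder (fun j => if j == l.+1 then i else a j) l.+1) =
  (mu (cylinder a l) * (P (a l) i)%:E)%E.
Proof.
rewrite !muP big_ord_recr /= eqxx (ltn_eqF (ltnSn l)) -EFinM mulrA.
congr (_ * _ * _)%:E; apply: eq_bigr => j _.
by rewrite eqSS (ltn_eqF (ltn_ord j)) (ltn_eqF (leqW (ltn_ord j))).
Qed.

(** The Markov property, by induction on [n] with the prefix [a] extended by one
    letter at each step. Only the upper bound is used, so that a cover of the
    event suffices in place of a disjoint decomposition. *)
Lemma cylinder_words_le (a : nat -> 'I_k) l n (G : pred (seq 'I_k)) :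
  (mu (cylinder a l `&` [set w | G (mkseq (fun j => w (l.+1 + j)%N) n)]) <=
   mu (cylinder a l) * (word_prob P n (a l) G)%:E)%E.
Proof.
have mG b j m (H : pred (seq 'I_k)) :
    measurable (cylinder b j `&` [set w | H (mkseq (fun i => w (j.+1 + i)%N) m)]
      : set (borel_Sigma hk)).
  apply: measurableI; first exact: measurable_cylinder.
  rewrite (_ : [set w | _] =
    [set w : Sigma hk | H (drop j.+1 (mkseq w (j.+1 + m)))]).
    exact: (@measurable_words _ _ _ [set s | H (drop j.+1 s)]).
  by apply/seteqP; split=> w; rewrite /mkset drop_mkseq.
elim: n a l G => [|n IH] a l G /=.
  case: (G [::]); rewrite ?mule1 ?mule0.
    rewrite (_ : _ `&` _ = cylinder a l)//.
    by apply/seteqP; split=> w; [case|split].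
  rewrite (_ : _ `&` _ = set0) ?measure0//.
  by apply/seteqP; split=> w // [].
pose b i := fun j => if j == l.+1 then i else a j.
pose F i : set (Sigma hk) := cylinder (b i) l.+1 `&`
  [set w | G (i :: mkseq (fun j => w (l.+2 + j)%N) n)].
have mF i : measurable (F i : set (borel_Sigma hk)).
  exact: (mG (b i) l.+1 n (fun s => G (i :: s))).
apply: (@le_trans _ _ (\sum_i mu (F i))%E).
  apply: measure_le_sum_cover => //.
  move=> w [wa /=]; rewrite mkseq_recl /= addn0 => Gw.
  exists (w l.+1) => //; split => [j|/=].
    rewrite /b; case: eqP => [->//|/eqP jl]; rewrite leq_eqVlt (negbTE jl) /=.
    exact: wa.
  by under eq_fun do rewrite addSnnS.
apply: (@le_trans _ _
    (\sum_i mu (cylinder a l) * (P (a l) i * word_prob P n i (fun s => G (i :: s)))%:E)%E).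
  apply: lee_sum => i _; apply: le_trans (IH (b i) l.+1 (fun s => G (i :: s))) _.
  by rewrite cylinder_prob_extend /b eqxx EFinM muleA.
have [c ->] : exists c, mu (cylinder a l) = c%:E by rewrite muP; eexists.
by rewrite -EFinM mulr_sumr -sumEFin; apply: lee_sum => i _; rewrite EFinM.
Qed.

Lemma words_le (n : nat) (G : pred (seq 'I_k)) c :
  \sum_i p 0 i = 1 -> (forall i, 0 <= p 0 i) ->
  (forall i, word_prob P n i (fun w => G (i :: w)) <= c) ->
  (mu [set w | G (mkseq w n.+1)] <= c%:E)%E.
Proof.
move=> p1 p0 Gc.
have mG i : measurable (cylinder (fun=> i) 0 `&` [set w | G (mkseq w n.+1)]
    : set (borel_Sigma hk)).
  apply: measurableI; first exact: measurable_cylinder.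
  exact: (@measurable_words _ _ n.+1 [set s | G s]).
apply: (@le_trans _ _
    (\sum_i mu (cylinder (fun=> i) 0 `&` [set w | G (mkseq w n.+1)]))%E).
  apply: measure_le_sum_cover => //.
    exact: (@measurable_words _ _ n.+1 [set s | G s]).
  by move=> w Gw; exists (w 0%N) => //; split => // j; rewrite leqn0 => /eqP ->.
rewrite -[leRHS]mul1e -p1 -sumEFin ge0_sume_distrl; last first.
  by move=> i _; rewrite lee_fin.
apply: lee_sum => i _.
have := cylinder_words_le (fun=> i) 0 n (fun w => G (i :: w)).
rewrite muP big_ord0 mulr1 => h.
apply: (@le_trans _ _ ((p 0 i)%:E * (word_prob P n i (fun w => G (i :: w)))%:E)%E).
  apply: le_trans h; rewrite le_eqVlt; apply/orP; left; apply/eqP; congr (mu _).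
  apply/seteqP; split=> w [wi] /=; rewrite ?mkseq_recl (wi 0%N)// => Gw; split => //=;
    by rewrite ?mkseq_recl ?(wi 0%N).
by rewrite -!EFinM lee_fin ler_wpM2l.
Qed.

End MarkovMeasure.

(** * Diameters of images *)

Section Diameter.
Context {R : realType} {k : nat}.
Variable T : 'I_k -> R -> R.
Hypothesis TI : forall i x, x \in `[0, 1] -> T i x \in `[0, 1].

Lemma diam_le (A : set R) c : A !=set0 ->
  (forall x y, A x -> A y -> `|x - y| <= c) -> diam A <= c.
Proof.
move=> [x Ax] Ac; apply: ge_sup; first by exists `|x - x|, (x, x).
by move=> _ [[y z] [/= Ay Az] <-]; exact: Ac.
Qed.

Lemma compo_diam_antitone (hk : (2 <= k)%N) (xi : Sigma hk) n m : (n <= m)%N ->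
  diam (compo T xi m @` `[0, 1]) <= diam (compo T xi n @` `[0, 1]).
Proof.
move=> nm; apply: diam_le.
  by exists (compo T xi m 0), 0 => //=; rewrite in_itv /= lexx ler01.
move=> _ _ [x xI <-] [y yI <-].
have [u uI ->] := compo_nested TI xi nm xI.
have [v vI ->] := compo_nested TI xi nm yI.
exact: dist_compo_le_diam.
Qed.

(** As the diameters decrease, convergence to 0 is a condition on single indices;
    this is what makes the set measurable. *)
Lemma weakly_hyperbolicP (hk : (2 <= k)%N) (xi : Sigma hk) :
  weakly_hyperbolic T xi <->
  forall m, exists n, diam (compo T xi n @` `[0, 1]) < m.+1%:R^-1.
Proof.
have zI : (0 : R) \in `[0, 1] by rewrite in_itv /= lexx ler01.
split=> [hyp m|hyp].
  have m0 : (0 : R) < m.+1%:R^-1 by rewrite invr_gt0.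
  move/cvgrPdist_lt : hyp => /(_ _ m0)[n _ /(_ n (leqnn n))] /=.
  by rewrite sub0r normrN => /(le_lt_trans (ler_norm _)); exists n.
apply/cvgrPdist_lt => e e0.
have [n nP] := hyp (Num.truncn e^-1).
exists n => // j /= nj; rewrite sub0r normrN ger0_norm; last first.
  by apply: le_trans (dist_compo_le_diam TI xi j zI zI); rewrite subrr normr0.
apply: le_lt_trans (compo_diam_antitone xi nj) (lt_trans nP _).
by rewrite invf_plt ?posrE// truncnS_gt.
Qed.

Lemma unit_interval_grid (e : R) : 0 < e -> exists K (g : 'I_K -> R),
  (forall i, g i \in `[0, 1]) /\
  forall u v, u \in `[0, 1] -> v \in `[0, 1] -> e < v - u ->
    exists i, u <= g i <= v.
Proof.
move=> e0; set K := (Num.truncn e^-1).+1.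
have K0 : (0 : R) < K%:R by rewrite ltr0n.
have Ke : K%:R^-1 < e by rewrite invf_plt ?posrE// truncnS_gt.
(* The first grid point to the right of u exceeds it by at most 1 / K < e. *)
exists K, (fun i => i%:R / K%:R); split=> [i|u v].
  rewrite in_itv /= divr_ge0 ?ler0n//= ler_pdivrMr// mul1r ler_nat.
  exact/ltnW/ltn_ord.
rewrite !in_itv /= => /andP[u0 u1] /andP[v0 v1] uv.
have uK0 : 0 <= u * K%:R by rewrite mulr_ge0// ltW.
have /andP[t1 t2] := truncn_itv uK0.
have tu : (Num.truncn (u * K%:R)).+1%:R / K%:R <= u + K%:R^-1.
  have -> : u + K%:R^-1 = (u * K%:R + 1) / K%:R.
    by rewrite mulrDl mulfK ?lt0r_neq0// mul1r.
  by rewrite ler_pM2r ?invr_gt0// -natr1 lerD2r.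
have iK : ((Num.truncn (u * K%:R)).+1 < K)%N.
  rewrite -(ltr_nat R) -[ltRHS]mul1r -ltr_pdivrMr//.
  by apply: (le_lt_trans tu); lra.
exists (Ordinal iK) => /=; rewrite ler_pdivlMr// (ltW t2) /=.
by apply: (le_trans tu); lra.
Qed.

Hypothesis Tcont : forall i, {within `[0, 1], continuous (T i)}.

(** The mesh [e / 2] leaves a margin below the supremum in [diam], so that no
    pair of points attaining it has to be found. *)
Lemma wide_image_hits_grid (e : R) : 0 < e -> exists K (g : 'I_K -> R),
  (forall i, g i \in `[0, 1]) /\
  forall s, e <= diam (word_map T s @` `[0, 1]) -> exists i, hits T (g i) s.
Proof.
move=> e0; have e2 : 0 < e / 2 by rewrite divr_gt0.
have [K [g [gI gP]]] := unit_interval_grid e2.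
exists K, g; split => // s se.
have [u [v [uI vI uv]]] : exists u v, [/\ u \in `[0, 1], v \in `[0, 1] &
    e / 2 < word_map T s v - word_map T s u].
  apply: contrapT => no; suff : diam (word_map T s @` `[0, 1]) <= e / 2 by lra.
  apply: diam_le.
    by exists (word_map T s 0), 0 => //=; rewrite in_itv /= lexx ler01.
  move=> _ _ [x xI <-] [y yI <-]; rewrite leNgt; apply/negP => xy; apply: no.
  have [d|d] := leP (word_map T s x) (word_map T s y).
    exists x, y; split => //; move: xy; rewrite distrC ger0_norm//; lra.
  by exists y, x; split => //; move: xy; rewrite ger0_norm//; lra.
have [i gi] := gP _ _ (word_map_itv TI s uI) (word_map_itv TI s vI) uv.
by exists i; exact: (word_map_ivt TI Tcont uI vI gi).
Qed.

End Diameter.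

(** * Splitting implies almost sure weak hyperbolicity *)

Section AlmostSureHyperbolicity.
Context {R : realType} {k : nat} {hk : (2 <= k)%N}.
Variables (T : 'I_k -> R -> R) (P : 'M[R]_k) (mu : probability (borel_Sigma hk) R).
Hypothesis TI : forall i x, x \in `[0, 1] -> T i x \in `[0, 1].

Let wide (m n : nat) : set (borel_Sigma hk) :=
  [set w | m.+1%:R^-1 <= diam (word_map T (mkseq w n.+1) @` `[0, 1])].

Let measurable_wide m n : measurable (wide m n).
Proof.
exact: (@measurable_words _ _ n.+1
  [set s | m.+1%:R^-1 <= diam (word_map T s @` `[0, 1])]).
Qed.

Let always_wide m := \bigcap_n wide m n.

Let measurable_always_wide m : measurable (always_wide m).
Proof. by apply: bigcap_measurableType => n _; exact: measurable_wide. Qed.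

Lemma weakly_hyperbolicE :
  @weakly_hyperbolic R k hk T = ~` \bigcup_m always_wide m.
Proof.
have image_compo (w : Sigma hk) n :
    compo T w n @` `[0, 1] = word_map T (mkseq w n.+1) @` `[0, 1].
  by congr image; apply/funext => x; rewrite compo_word_map.
apply/seteqP; split=> w.
  move=> /(weakly_hyperbolicP TI) hyp [m _ ww].
  have [n] := hyp m; rewrite image_compo ltNge => /negP; apply.
  exact: ww.
move=> now; apply/(weakly_hyperbolicP TI) => m; apply: contrapT => /forallNP no.
apply: now; exists m => // n _; rewrite /wide /= leNgt -image_compo.
exact/negP/no.
Qed.

Lemma measurable_weakly_hyperbolic :
  measurable (@weakly_hyperbolic R k hk T : set (borel_Sigma hk)).
Proof.
rewrite weakly_hyperbolicE; apply: measurableC.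
by apply: bigcupT_measurable => m; exact: measurable_always_wide.
Qed.

Lemma ge0_le_geometric_eq0 (x : \bar R) (C c : R) : (0 <= x)%E -> 0 <= c < 1 ->
  (forall j, (x <= (C * c ^+ j)%:E)%E) -> x = 0%E.
Proof.
move=> x0 /andP[c0 c1] xc; apply/eqP; rewrite eq_le x0 andbT.
apply/lee_addgt0Pr => e e0; rewrite add0e.
have /cvgrPdist_lt/(_ _ e0)[j _ /(_ j (leqnn j))] :
    (geometric C c) @ \oo --> 0 by apply: cvg_geometric; rewrite ger0_norm.
rewrite /= sub0r normrN => /(le_lt_trans (ler_norm _))/ltW ce.
by apply: le_trans (xc j) _; rewrite lee_fin.
Qed.

Hypothesis Tcont : forall i, {within `[0, 1], continuous (T i)}.
Hypothesis Tinj : forall i, {in `[0, 1] &, injective (T i)}.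

(** For fixed [m], the event that all diameters are at least [1 / m.+1] has
    probability at most [K * c ^ j] for every [j], where [K] is the size of the
    grid; a countable union of null events is null. *)
Lemma splitting_weakly_hyperbolic : markov_measure P mu -> splitting P T ->
  mu (weakly_hyperbolic T) = 1%E.
Proof.
move=> [tP iP [p [p0 p1 _] muP]] spl.
have [N [c [c0 c1 Nc]]] := splitting_hit_prob_geometric tP TI Tinj iP spl.
have hits_le j x : x \in `[0, 1] ->
    (mu [set w | hits T x (mkseq w (j * N).+1)] <= (c ^+ j)%:E)%E.
  move=> xI.
  apply: (@words_le _ _ _ P p mu muP (j * N) (hits T x) _ p1 p0) => i.
  have [[y yI xy]|xN] := hits_cons_preimage TI Tinj i x.
    by rewrite (eq_word_prob _ _ _ xy); exact: Nc.
  by rewrite (@eq_word_prob _ _ _ _ _ _ pred0)// word_prob_pred0 exprn_ge0.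
have always_wide0 m : mu (always_wide m) = 0%E.
  have m0 : (0 : R) < m.+1%:R^-1 by rewrite invr_gt0.
  have [K [g [gI gP]]] := wide_image_hits_grid TI Tcont m0.
  apply: (@ge0_le_geometric_eq0 _ K%:R c) => // [|j]; first by rewrite c0.
  apply: (@le_trans _ _ (mu (wide m (j * N)))).
    by apply: le_measure; rewrite ?inE//; exact: bigcap_inf.
  apply: (@le_trans _ _
      (\sum_i mu [set w | hits T (g i) (mkseq w (j * N).+1)])%E).
    apply: measure_le_sum_cover => // [i|w /gP[i]]; last by exists i.
    exact: (@measurable_words _ _ (j * N).+1 [set s | hits T (g i) s]).
  apply: (@le_trans _ _ (\sum_(i < K) (c ^+ j)%:E)%E).
    by apply: lee_sum => i _; exact: hits_le.
  by rewrite sumEFin sumr_const card_ord mulr_natl.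
have mU : measurable (\bigcup_m always_wide m) by exact: bigcupT_measurable.
have U0 : mu (\bigcup_m always_wide m) = 0%E.
  apply/negligibleP => //; apply: negligible_bigcup => m.
  by apply/negligibleP; [exact: measurable_always_wide|exact: always_wide0].
by rewrite weakly_hyperbolicE probability_setC// [X in (_ - X)%E]U0 sube0.
Qed.

End AlmostSureHyperbolicity.

(** * The support of the Markov measure *)

Section Support.
Context {R : realType} {k : nat} {hk : (2 <= k)%N}.
Variables (P : 'M[R]_k) (mu : probability (borel_Sigma hk) R).

Lemma path_weight_mkseq_gt0 (f : nat -> 'I_k) m n :
  (forall j, 0 < P (f j) (f j.+1)) -> 0 < P m (f 0%N) ->
  0 < path_weight P m (mkseq f n).
Proof.
elim: n f m => [|n IH] f m fP Pm; first exact: ltr01.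
rewrite mkseq_recl /= mulr_gt0//.
by apply: IH => [j|]; exact: fP.
Qed.

(** Cylinders around a point of the support have positive measure, so that none
    of its transitions is forbidden. *)
Lemma supp_path_weight (xi : Sigma hk) m n : markov_measure P mu -> supp mu xi ->
  0 < P m (xi 0%N) -> 0 < path_weight P m (mkseq xi n).
Proof.
move=> [[P0 _] _ [p [p0 _ _] muP]] sxi; apply: path_weight_mkseq_gt0 => j.
rewrite lt_neqAle P0 andbT; apply/negP => /eqP Pj.
have := sxi _ (@open_cylinder _ hk xi j.+1) (fun _ _ => erefl).
by rewrite muP big_ord_recr /= -Pj !mulr0 ltxx.
Qed.

(** A point outside the support lies in a null cylinder, and there are only
    countably many cylinders, one for each finite word. *)
Lemma negligible_supp_compl : mu.-negligible (~` supp mu).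
Proof.
pose word_cylinder s : set (borel_Sigma hk) := [set w | mkseq w (size s) = s].
have mW s : measurable (word_cylinder s).
  exact: (@measurable_words _ _ (size s) [set s]).
pose F n := if unpickle n is Some s then
  if mu (word_cylinder s) == 0%E then word_cylinder s else set0 else set0.
apply: (@negligibleS _ _ _ _ (\bigcup_n F n)).
  move=> w /existsNP[U /not_implyP[oU /not_implyP[Uw /negP]]].
  rewrite -leNgt => muU.
  have [l lU] : exists l, cylinder w l `<=` U.
    by apply: nbhs_cylinder_sub; exact: open_nbhs_nbhs.
  have WU : word_cylinder (mkseq w l.+1) `<=` U.
    move=> v; rewrite /word_cylinder /mkset size_mkseq => vw.
    by apply: lU; apply/cylinder_mkseq.
  exists (pickle (mkseq w l.+1)) => //; rewrite /F pickleK.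
  suff -> : mu (word_cylinder (mkseq w l.+1)) = 0%E.
    by rewrite eqxx /word_cylinder /mkset size_mkseq.
  apply/eqP; rewrite eq_le measure_ge0 andbT; apply: le_trans muU.
  apply: le_measure; rewrite ?inE//.
  exact: sub_sigma_algebra.
apply: negligible_bigcup => n; rewrite /F.
case: (unpickle n) => [s|]; last exact: negligible_set0.
by case: eqP => [s0|_]; [exact/negligibleP|exact: negligible_set0].
Qed.

Lemma probability1_meets_supp (A : set (borel_Sigma hk)) :
  measurable A -> mu A = 1%E -> A `&` supp mu !=set0.
Proof.
move=> mA A1; apply/set0P/eqP => A0; suff : mu A = 0%E.
  by rewrite A1 => /eqP; rewrite onee_eq0.
apply: measure_negligible => //; apply: negligibleS negligible_supp_compl.
by apply/disjoints_subset.
Qed.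

End Support.

(** * Sources of splitting *)

Section Splitting.
Context {R : realType} {k : nat} {hk : (2 <= k)%N}.
Variables (T : 'I_k -> R -> R) (P : 'M[R]_k) (mu : probability (borel_Sigma hk) R).
Hypothesis TI : forall i x, x \in `[0, 1] -> T i x \in `[0, 1].
Hypothesis Tcont : forall i, {within `[0, 1], continuous (T i)}.

Lemma compo_near_coding (xi : Sigma hk) (e : R) : weakly_hyperbolic T xi -> 0 < e ->
  exists n, forall m x, (n <= m)%N -> x \in `[0, 1] ->
    `|coding T xi - compo T xi m x| < e.
Proof.
move=> hyp e0; have e2 : 0 < e / 2 by rewrite divr_gt0.
have zI : (0 : R) \in `[0, 1] by rewrite in_itv /= lexx ler01.
have /cvgrPdist_lt/(_ _ e2)[n1 _ n1P] := cvg_coding TI hyp zI.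
have /cvgrPdist_lt/(_ _ e2)[n2 _ n2P] := hyp.
exists (maxn n1 n2) => m x; rewrite geq_max => /andP[m1 m2] xI.
apply: le_lt_trans (ler_distD (compo T xi m 0) _ _) _.
rewrite [e]splitr ltrD//; first exact: n1P.
apply: le_lt_trans (dist_compo_le_diam TI xi m zI xI) _.
by have := n2P m m2; rewrite /= sub0r normrN; apply: le_lt_trans (ler_norm _).
Qed.

Lemma coding_itv (xi : Sigma hk) : weakly_hyperbolic T xi -> coding T xi \in `[0, 1].
Proof.
move=> hyp; have zI : (0 : R) \in `[0, 1] by rewrite in_itv /= lexx ler01.
rewrite in_itv /=; apply/andP; split; rewrite leNgt; apply/negP => c.
  have e0 : 0 < - coding T xi by rewrite oppr_gt0.
  have [n /(_ n 0 (leqnn n) zI)] := compo_near_coding hyp e0.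
  have := compo_itv TI xi n zI; rewrite in_itv /= ltr_norml => /andP[? _] /andP[]; lra.
have e0 : 0 < coding T xi - 1 by rewrite subr_gt0.
have [n /(_ n 0 (leqnn n) zI)] := compo_near_coding hyp e0.
have := compo_itv TI xi n zI; rewrite in_itv /= ltr_norml => /andP[_ ?] /andP[]; lra.
Qed.

(** The words [c] and [d] followed by long prefixes of [xi] and [eta] have images
    close to two distinct points, by continuity of [word_map T c] and
    [word_map T d] at the two codings. *)
Lemma splitting_of_codings m (c d : seq 'I_k) (xi eta : Sigma hk) :
  markov_measure P mu ->
  supp mu xi -> weakly_hyperbolic T xi -> supp mu eta -> weakly_hyperbolic T eta ->
  0 < path_weight P m (rcons c (xi 0%N)) ->
  0 < path_weight P m (rcons d (eta 0%N)) ->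
  word_map T c (coding T xi) <> word_map T d (coding T eta) ->
  splitting P T.
Proof.
move=> muM sxi hxi seta heta mc md /eqP neq.
have [tP _ _] := muM.
set x := word_map T c _ in neq; set y := word_map T d _ in neq.
pose e := `|x - y| / 2.
have e0 : 0 < e by rewrite divr_gt0// normr_gt0 subr_eq0.
have tail f (zeta : Sigma hk) : supp mu zeta -> weakly_hyperbolic T zeta ->
    0 < path_weight P m (rcons f (zeta 0%N)) ->
    exists n, forall l, (n <= l)%N ->
      0 < path_weight P m (f ++ mkseq zeta l.+1) /\
      forall z, hits T z (f ++ mkseq zeta l.+1) ->
        `|word_map T f (coding T zeta) - z| < e.
  move=> szeta hzeta; rewrite -cats1 path_weight_cat /= mulr1 => mf.
  have wf : 0 < path_weight P m f.
    rewrite lt_neqAle path_weight_ge0// andbT.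
    by apply: contraTneq mf => <-; rewrite mul0r ltxx.
  have [r r0 rP] := word_map_continuous TI Tcont f (coding_itv hzeta) e0.
  have [n nP] := compo_near_coding hzeta r0.
  exists n => l nl; split=> [|z /asboolP[t tI <-]].
    rewrite path_weight_cat mulr_gt0//; apply: supp_path_weight szeta _ => //.
    by rewrite -(pmulr_rgt0 _ wf).
  rewrite word_map_cat -compo_word_map; apply: rP; last exact: nP.
  exact: compo_itv.
have [n1 n1P] := tail c xi sxi hxi mc; have [n2 n2P] := tail d eta seta heta md.
have [wa ha] := n1P _ (leq_maxl n1 n2); have [wb hb] := n2P _ (leq_maxr n1 n2).
eexists; eexists; eexists; split; [exact: wa|exact: wb|move=> z].
apply/negP => /andP[/ha xz /hb yz].
have := ler_distD z x y; rewrite leNgt => /negP; apply.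
by rewrite [ltRHS]splitr ltrD// distrC.
Qed.

Lemma splitting_of_nonconstant_coding i : markov_measure P mu ->
  ~ constant_on (coding T) (cylinder (fun=> i) 0 `&` supp mu `&` weakly_hyperbolic T) ->
  splitting P T.
Proof.
move=> muM /existsNP[xi /existsNP[eta /not_implyP[[[xi0 sxi] hxi]]]].
move=> /not_implyP[[[eta0 seta] heta] neq]; have [tP iP _] := muM.
have [m mi] := irreducible_pred i tP iP.
by apply: (@splitting_of_codings m [::] [::] xi eta) => //=;
  rewrite ?xi0 ?eta0 ?mulr1.
Qed.

(** Sequences with [k.+1] distinct codings cannot have pairwise distinct first
    letters. *)
Lemma pigeonhole_nonconstant_coding :
  ([set: 'I_k.+1] #<= coding T @` (weakly_hyperbolic T `&` supp mu))%card ->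
  exists i, ~ constant_on (coding T)
    (cylinder (fun=> i) 0 `&` supp mu `&` weakly_hyperbolic T).
Proof.
move=> /pcard_leP/unsquash f; apply/existsNP => const.
have /choice[xi xiP] : forall j, exists xi : Sigma hk,
    (weakly_hyperbolic T `&` supp mu) xi /\ coding T xi = f j.
  move=> j; suff [xi ? ?] : (coding T @` (weakly_hyperbolic T `&` supp mu)) (f j).
    by exists xi.
  exact: funS.
have : injective (fun j => xi j 0%N).
  have finj : {in [set: 'I_k.+1] &, injective f} by exact: inj.
  move=> j1 j2 e; apply: finj; rewrite ?inE//.
  have [[h1 s1] <-] := xiP j1; have [[h2 s2] <-] := xiP j2.
  by apply: (const (xi j1 0%N)); split=> //; split=> // l; rewrite leqn0 => /eqP ->.
by move/leq_card; rewrite !card_ord ltnn.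
Qed.

(** Any two states have a common predecessor, and the word [j :: w], which can
    be followed by [xi], moves the coding of [xi] to another point. *)
Lemma splitting_of_no_common_fixpoint (xi : Sigma hk) : markov_measure P mu ->
  ~ (exists2 x : R, x \in `[0, 1] & forall i, T i x = x) ->
  (forall i j : 'I_k, i != j -> exists m : 'I_k, 0 < P m i * P m j) ->
  weakly_hyperbolic T xi -> supp mu xi -> splitting P T.
Proof.
move=> muM nofix common hxi sxi; have [tP iP _] := muM.
have [P0 _] := tP.
pose x := coding T xi.
have [j [w [jw nx]]] : exists j w, 0 < path_weight P j (rcons w (xi 0%N)) /\
    word_map T (j :: w) x <> x.
  apply: contrapT => no; apply: nofix; exists x; first exact: coding_itv.
  have fixed j w : 0 < path_weight P j (rcons w (xi 0%N)) -> word_map T (j :: w) x = x.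
    by move=> jw; apply: contrapT => nx; apply: no; exists j, w.
  move=> j; have [w [w0 wl jw]] := irreducible_path j (xi 0%N) tP iP.
  case/lastP: w w0 wl jw => // w l _; rewrite last_rcons => -> jw.
  have wx : word_map T w x = x.
    case: w jw => // i w /= jw; apply: (fixed i w).
    rewrite lt_neqAle path_weight_ge0// andbT.
    by apply: contraTneq jw => <-; rewrite mulr0 ltxx.
  by rewrite -[LHS]/(T j x) -{1}wx; exact: fixed.
have [m [mj mx]] : exists m, 0 < P m j /\ 0 < P m (xi 0%N).
  have [->|/common[m mP]] := eqVneq j (xi 0%N).
    by have [m ?] := irreducible_pred (xi 0%N) tP iP; exists m.
  have mj : 0 < P m j.
    by rewrite lt_neqAle P0 andbT; apply: contraTneq mP => <-; rewrite mul0r ltxx.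
  by exists m; rewrite mj -(pmulr_rgt0 _ mj).
apply: (@splitting_of_codings m (j :: w) [::] xi xi) => //=.
- by rewrite mulr_gt0.
- by rewrite mulr1.
Qed.

End Splitting.

Theorem theorem4p8 (R : realType) (k : nat) (hk : (2 <= k)%N)
    (T : 'I_k -> R -> R) (P : 'M[R]_k) (mu : probability (borel_Sigma hk) R)
    (T_itv : forall i x, x \in `[0, 1] -> T i x \in `[0, 1])
    (T_cont : forall i, {within `[0, 1], continuous (T i)})
    (T_inj : forall i, {in `[0, 1] &, injective (T i)})
    (mu_markov : markov_measure P mu)
    (mu_mixing : mixing mu) :
  (((exists i : 'I_k,
       ~ constant_on (coding T)
           (cylinder (fun=> i) 0 `&` supp mu `&` weakly_hyperbolic T)) ->
    mu (weakly_hyperbolic T) = 1%E) /\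
   (([set: 'I_k.+1] #<= coding T @` (weakly_hyperbolic T `&` supp mu))%card ->
    mu (weakly_hyperbolic T) = 1%E)) /\
  (~ (exists2 x : R, x \in `[0, 1] & forall i, T i x = x) ->
   (forall i j : 'I_k, i != j -> exists m : 'I_k, 0 < P m i * P m j) ->
   (weakly_hyperbolic T `&` supp mu !=set0 <->
    mu (weakly_hyperbolic T) = 1%E)).
Proof.
have split1 : splitting P T -> mu (weakly_hyperbolic T) = 1%E.
  exact: splitting_weakly_hyperbolic.
have nonconst : (exists i : 'I_k, ~ constant_on (coding T)
    (cylinder (fun=> i) 0 `&` supp mu `&` weakly_hyperbolic T)) ->
    mu (weakly_hyperbolic T) = 1%E.
  by move=> [i iN]; apply: split1; exact: splitting_of_nonconstant_coding iN.
split; first by split=> // /pigeonhole_nonconstant_coding; exact: nonconst.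
move=> nofix common; split=> [[xi [hxi sxi]]|S1].
  by apply: split1; exact: (splitting_of_no_common_fixpoint T_itv T_cont
    mu_markov nofix common hxi sxi).
apply: probability1_meets_supp S1; exact: measurable_weakly_hyperbolic.
Qed.
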